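(* Let $(M,d)$ be a metric space and $\{\mathcal{T}(t):t\ge0\}$ a semigroup in $M$ with global attractor $\mathcal{A}$. Let $\mathcal{U}\supset\mathcal{A}$ be a bounded positively invariant set that is exponentially attracted by $\mathcal{A}$, i.e. there exist $C,\gamma>0$ with $dist_H(\mathcal{T}(n)\,\mathcal{U},\mathcal{A})\le Ce^{-\gamma n}$ for all $n\in\mathbb{N}$, and suppose that $\mathcal{T}(1)|_{\mathcal{U}}$ is Lipschitz. For each $n\in\mathbb{N}$ let $L_n=\mathrm{Lip}(\mathcal{T}(n)|_{\mathcal{U}})$ be the Lipschitz constant of $\mathcal{T}(n)|_{\mathcal{U}}$. Then: (1) If $\displaystyle\limsup_{n\to+\infty}\frac{n}{\ln L_n}=+\infty$, then there exists $C_3>0$ satisfying: for any $\alpha\in(0,1)$ there exists $N\in\mathbb{N}$ such that if $\{\mathcal{T}_\epsilon(t):t\ge0\}\subset\mathcal{C}(M)$ is a semigroup with global attractor $\mathcal{A}_\epsilon\subset\mathcal{U}$, then $$dist_H(\mathcal{A}_\epsilon,\mathcal{A})\le C_3\,\|\mathcal{T}(N)-\mathcal{T}_\epsilon(N)\|^{\alpha}_{L^\infty(\mathcal{U},M)}.$$ (2) If $\displaystyle\lim_{n\to+\infty}\frac{n}{\ln L_n}=+\infty$, then there exists $C_3>0$ satisfying: for any $\alpha\in(0,1)$ there exists $N\in\mathbb{N}$ such that if $\{\mathcal{T}_\epsilon(t):t\ge0\}\subset\mathcal{C}(M)$ is a semigroup with global attractor $\mathcal{A}_\epsilon\subset\mathcal{U}$,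 then $$dist_H(\mathcal{A}_\epsilon,\mathcal{A})\le C_3\inf_{n\ge N}\|\mathcal{T}(n)-\mathcal{T}_\epsilon(n)\|^{\alpha}_{L^\infty(\mathcal{U},M)}.$$ (3) If $\displaystyle\limsup_{n\to+\infty}\frac{n}{\ln L_n}=+\infty$ and $\mathcal{T}(1)|_{\mathcal{A}}:\mathcal{A}\to\mathcal{A}$ has the Lipschitz Shadowing property, then given $\alpha\in(0,1)$ there exists $C_3>0$ satisfying: for any semigroup $\{\mathcal{T}_\epsilon(t):t\ge0\}\subset\mathcal{C}(M)$ with a global attractor $\mathcal{A}_\epsilon\subset\mathcal{U}$, $$dist_H(\mathcal{A}_\epsilon,\mathcal{A})\le C_3\,\|\mathcal{T}(1)-\mathcal{T}_\epsilon(1)\|^{\alpha}_{L^\infty(\mathcal{U},M)}.$$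
   Context: A semigroup in $(M,d)$ is a family $\{\mathcal{T}(t):t\ge0\}\subset\mathcal{C}(M)$ of continuous maps $M\to M$ with $\mathcal{T}(0)=I$, $\mathcal{T}(t)\mathcal{T}(s)=\mathcal{T}(t+s)$ for $t,s\ge0$, and $(t,x)\mapsto\mathcal{T}(t)x$ continuous. A set $S$ is positively invariant if $\mathcal{T}(t)S\subset S$ for all $t\ge0$. The Hausdorff semi-distance is $dist_H(A_1,A_2)=\sup_{a_1\in A_1}\inf_{a_2\in A_2}d(a_1,a_2)$. A global attractor is a compact set $\mathcal{A}\subset M$ with $\mathcal{T}(t)\mathcal{A}=\mathcal{A}$ for all $t\ge0$ and $dist_H(\mathcal{T}(t)B,\mathcal{A})\to0$ as $t\to+\infty$ for each bounded $B\subset M$. For maps $F,G$ into $M$, $\|F-G\|_{L^\infty(\mathcal{U},M)}=\sup_{x\in\mathcal{U}}d(F(x),G(x))$. A map $F:Y\to Y$ of a metric space has the Lipschitz Shadowing property if there exist $\delta_0,L>0$ such that for every $\delta\in[0,\delta_0]$ and every sequence $\{x_n\}_{n\in\mathbb{Z}}\subset Y$ with $d(Fx_n,x_{n+1})\le\delta$ for all $n\in\mathbb{Z}$, there is a sequence $\{z_n\}_{n\in\mathbb{Z}}\subset Y$ with $Fz_n=z_{n+1}$ and $d(x_n,z_n)\le L\delta$ for all $n\in\mathbb{Z}$. *)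

(* Defs.v *)
From HB Require Import structures.
From mathcomp Require Import all_boot all_order all_algebra.
From mathcomp Require Import all_classical all_reals all_analysis.

Set Implicit Arguments.
Unset Strict Implicit.
Unset Printing Implicit Defensive.

Import Order.TTheory GRing.Theory Num.Theory.
Import numFieldNormedType.Exports.

Local Open Scope classical_set_scope.
Local Open Scope ring_scope.

Section Definitions.
Context {R : realType} {M : metricType R}.
Implicit Types (A B U Y S : set M) (F G : M -> M) (T : R -> M -> M).

(* Times are the nonnegative reals: the values of [T] at negative times are
   unconstrained, and no definition below looks at them. *)
Record semigroup T : Prop := Semigroup {
  semigroup_cont_map : forall t : R, 0 <= t -> continuous (T t) ;
  semigroup0 : T 0 = id ;
  semigroupD : forall t s : R, 0 <= t -> 0 <= s -> T t \o T s = T (t + s) ;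
  semigroup_cont :
    {within [set p : R * M | 0 <= p.1], continuous (fun p => T p.1 p.2)} }.

Definition positively_invariant T S : Prop :=
  forall t : R, 0 <= t -> T t @` S `<=` S.

(* The library's [bounded_set] only makes sense in a normed module. *)
Definition mbounded B : Prop :=
  exists r : R, forall x y, B x -> B y -> mdist x y <= r.

(* The supremum is taken in [0, +oo], so that it is 0 over the empty set
   (whereas [ereal_sup set0 = -oo]); hence the [maxe 0]. *)
Definition dist_H A B : \bar R :=
  maxe 0%E
    (ereal_sup [set ereal_inf [set (mdist a b)%:E | b in B] | a in A]).

Record global_attractor T A : Prop := GlobalAttractor {
  attractor_compact : compact A ;
  attractor_inv : forall t : R, 0 <= t -> T t @` A = A ;
  attractor_attracts : forall B, mbounded B ->
    dist_H (T t @` B) A @[t --> +oo%R] --> 0%E }.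

Definition exp_attracted T A U : Prop :=
  exists C gamma : R, [/\ 0 < C, 0 < gamma &
    forall n : nat,
      (dist_H (T n%:R @` U) A <= (C * expR (- (gamma * n%:R)))%:E)%E].

(* Again a supremum in [0, +oo]. *)
Definition Linfty_dist U F G : \bar R :=
  maxe 0%E (ereal_sup [set (mdist (F x) (G x))%:E | x in U]).

(* The library's [lipschitz] predicates are restricted to normed modules. *)
Definition lipschitz_with (k : R) U F : Prop :=
  0 <= k /\ forall x y, U x -> U y -> mdist (F x) (F y) <= k * mdist x y.

(* The least Lipschitz constant of the restriction of [F] to [U]; it is +oo
   when that restriction is not Lipschitz. *)
Definition Lip U F : \bar R :=
  ereal_inf [set k%:E | k in [set k | lipschitz_with k U F]].

(* n / ln L_n in the extended reals: [lne 0 = -oo], and [0^-1 = +oo], so the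
   ratio is +oo when L_n = 1 and n > 0. It is not +oo when L_n < 1. *)
Definition lip_ratio T U (n : nat) : \bar R :=
  (n%:R%:E / lne (Lip U (T n%:R)))%E.

(* Lipschitz shadowing for the restriction F : Y -> Y, where Y carries the
   metric of M; used for Y with F @` Y `<=` Y. *)
Definition lipschitz_shadowing Y F : Prop :=
  exists delta0 L : R, [/\ 0 < delta0, 0 < L &
    forall delta : R, 0 <= delta <= delta0 ->
    forall x : int -> M, (forall n, Y (x n)) ->
      (forall n : int, mdist (F (x n)) (x (n + 1)) <= delta) ->
      exists z : int -> M, [/\ forall n, Y (z n),
        forall n : int, F (z n) = z (n + 1) &
        forall n : int, mdist (x n) (z n) <= L * delta]].

End Definitions.

(* Main.v *)
Require Import Defs.
From mathcomp Require Import all_boot all_order all_algebra.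
From mathcomp Require Import all_classical all_reals all_analysis.
From mathcomp Require Import ring lra.
Import Order.TTheory GRing.Theory Num.Theory.
Import numFieldNormedType.Exports.
Local Open Scope classical_set_scope.
Local Open Scope ring_scope.

Set Implicit Arguments.
Unset Strict Implicit.

(** Write a point of the perturbed attractor as Te(kn)b with b in the perturbed
    attractor. If Te(n) is delta-close to T(n) and T(n) has Lipschitz constant
    lam on U, then Te(kn)b is within delta * (1 + lam + ... + lam^(k-1)) of
    T(kn)b, which is itself within C * exp(-gamma * k * n) of A. The growth
    condition on Lip T(n) yields some n with lam = exp(eta * n), where
    eta = gamma * (1 - alpha) / 2; taking k * n close to
    alpha * ln(1/delta) / gamma makes both errors O(delta^alpha), with a
    constant independent of alpha. In the third part, the same telescoping in
    unit steps bounds the distance between T(N) and Te(N) by a multiple of the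
    distance between T(1) and Te(1). *)

Lemma dist_error_tradeoff (R : realType) (C gamma alpha delta : R) (n : nat) :
  0 <= C -> 0 < gamma -> 0 < alpha < 1 -> 0 < delta ->
  1 <= gamma * (1 - alpha) / 2 * n%:R ->
  exists k : nat,
    C * expR (- (gamma * (k * n)%:R)) +
      delta * (\sum_(j < k) expR (gamma * (1 - alpha) / 2 * n%:R) ^+ j) <=
    (C + 1) * delta `^ alpha.
Proof.
move=> C0 g0 /andP[a0 a1] d0; set eta := gamma * (1 - alpha) / 2 => etan.
have eta0 : 0 < eta by rewrite divr_gt0// mulr_gt0// subr_gt0.
have n0 : 0 < n%:R :> R.
  by rewrite -(pmulr_rgt0 _ eta0) (lt_le_trans ltr01).
have powE : delta `^ alpha = expR (alpha * ln delta) by rewrite /powR gt_eqF.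
(* For [delta >= 1] the right-hand side is at least [C + 1], so zero iterations suffice. *)
have [d1|d1] := leP 1 delta.
  exists 0%N; rewrite mul0n big_ord0 !mulr0 addr0 oppr0 expR0 mulr1.
  have : 1 <= delta `^ alpha.
    by rewrite powE -expR0 ler_expR mulr_ge0 ?(ltW a0)// ln_ge0.
  by nra.
have l0 : ln delta < 0 by apply: ln_lt0; rewrite d0.
set l := ln delta in l0 powE.
have gn0 : 0 < gamma * n%:R by rewrite mulr_gt0.
(* [m] is the integer part of [alpha * ln(1/delta) / (gamma * n)]. Taking [m.+1] iterations brings
   the decay term below [C * delta^alpha], while the geometric sum stops at exponent [m], which the
   lower half of the bracketing controls. *)
have [m] : exists m : nat,
    m%:R <= - (alpha * l) / (gamma * n%:R) < m.+1%:R.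
  exists (Num.truncn (- (alpha * l) / (gamma * n%:R))).
  by apply: truncn_itv; rewrite divr_ge0 ?(ltW gn0)//; nra.
rewrite ler_pdivlMr// ltr_pdivrMr// => /andP[mle mgt].
exists m.+1; rewrite mulrDl mul1r; apply: lerD.
  by rewrite ler_wpM2l// powE ler_expR natrM; nra.
(* Each term is at most the last one, and [1 <= eta * n] lets the number of terms be absorbed: [m +
   1 <= 1 + eta * n * m <= exp(eta * n * m)]. *)
have sumle : \sum_(j < m.+1) expR (eta * n%:R) ^+ j <=
    expR (2 * (eta * (m%:R * n%:R))).
  apply: (@le_trans _ _ (\sum_(j < m.+1) expR (eta * n%:R) ^+ m)).
    apply: ler_sum => j _; rewrite ler_eXn2l ?leq_ord//.
    by rewrite (lt_le_trans _ (expR_ge1Dx _))// ltrDl (lt_le_trans ltr01).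
  rewrite sumr_const card_ord -[leLHS]mulr_natl -expRM_natr.
  have -> : 2 * (eta * (m%:R * n%:R)) =
      eta * n%:R * m%:R + eta * n%:R * m%:R by ring.
  rewrite expRD ler_wpM2r ?expR_ge0// (le_trans _ (expR_ge1Dx _))//.
  by rewrite -natr1 addrC lerD2l ler_peMl.
rewrite -[X in X * _](@lnK _ delta) ?posrE// -/l.
rewrite (le_trans (ler_wpM2l (expR_ge0 _) sumle))// powE -expRD ler_expR.
have etaE : 2 * (eta * (m%:R * n%:R)) = (1 - alpha) * (m%:R * (gamma * n%:R)).
  by rewrite /eta; field.
rewrite etaE.
have a1' : 0 <= 1 - alpha by rewrite subr_ge0 ltW.
apply: (le_trans (lerD (lexx l) (ler_wpM2l a1' mle))).
(* The exponent of [delta] reached is [1 - alpha * (1 - alpha)], which exceeds the required [alpha]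
   by [(1 - alpha)^2]. *)
have : (1 - alpha) ^+ 2 * l <= 0 by rewrite mulr_ge0_le0 ?exprn_ge0// ltW.
by nra.
Qed.

Section Lipschitz.
Context {R : realType} {M : metricType R}.
Implicit Types (A U E : set M) (F G : M -> M) (T : R -> M -> M).

Lemma lipschitz_withS (k l : R) U F :
  k <= l -> lipschitz_with k U F -> lipschitz_with l U F.
Proof.
move=> kl [k0 kF]; split=> [|x y Ux Uy]; first exact: le_trans kl.
by rewrite (le_trans (kF _ _ Ux Uy))// ler_wpM2r// mdist_ge0.
Qed.

(** A ratio above [K] means [ln L_n < n / K], so some admissible constant lies below [exp(n / K)].
    The conventions need care: [L_n = 1] gives ratio [+oo] if [n > 0] and [0] if [n = 0];
    [L_n = +oo] gives ratio [0]; for [L_n < 1] the conclusion holds whatever the ratio. *)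
Lemma lip_ratio_lipschitz T U (K : R) (n : nat) : 0 < K ->
  (K%:E < lip_ratio T U n)%E -> lipschitz_with (expR (n%:R / K)) U (T n%:R).
Proof.
move=> K0 Kn.
suff /ereal_inf_lt[_ [k kU <-]] : (Lip U (T n%:R) < (expR (n%:R / K))%:E)%E.
  by rewrite lte_fin => /ltW kl; exact: lipschitz_withS kU.
move: Kn; rewrite /lip_ratio; case: (Lip U (T n%:R)) => [r| |] /=.
- case: (leP r 0) => [r0 _|r0]; first by rewrite lte_fin (le_lt_trans r0)// expR_gt0.
  rewrite lte_fin inver; case: eqVneq => [lr0|lr0].
    have [->|n0] := posnP n; first by rewrite mul0e lte_fin ltNge ltW.
    move=> _; rewrite -[X in X < _](@lnK _ r) ?posrE// lr0 ltr_expR.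
    by rewrite divr_gt0// ltr0n.
  rewrite -EFinM lte_fin => Kn; rewrite -[X in X < _](@lnK _ r) ?posrE//.
  rewrite ltr_expR ltr_pdivlMr//; have [l0|l0] := ltP (ln r) 0.
    by rewrite (lt_le_trans (_ : _ < 0))// nmulr_rlt0.
  by move: Kn; rewrite ltr_pdivlMr 1?mulrC// lt_neqAle eq_sym lr0.
- by rewrite mule0 lte_fin ltNge ltW.
- by rewrite ltNyr.
Qed.

End Lipschitz.

(** The limit superior is an infimum of suprema that include those over tails, so every tail has
    supremum [+oo]. *)
Lemma limn_esup_pinfty (R : realType) (u : nat -> \bar R) :
  limn_esup u = +oo%E ->
  forall (K : R) (n0 : nat), exists2 n, (n0 <= n)%N & (K%:E < u n)%E.
Proof.
move=> uy K n0.
have : (+oo <= ereal_sup (u @` [set n | (n0 <= n)%N]))%E.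
  rewrite -uy; apply: ereal_inf_lbound.
  by exists [set n | (n0 <= n)%N] => //; exists n0.
rewrite leye_eq => /eqP supy.
have /ereal_sup_gt[_ [n n0n <-] Kn] :
    (K%:E < ereal_sup (u @` [set n | (n0 <= n)%N]))%E by rewrite supy ltry.
by exists n.
Qed.

Section Semigroups.
Context {R : realType} {M : metricType R}.
Implicit Types (A U E : set M) (F G : M -> M) (T Te : R -> M -> M).

Lemma mdist_le_Linfty_dist U F G x :
  U x -> ((mdist (F x) (G x))%:E <= Linfty_dist U F G)%E.
Proof.
by move=> Ux; rewrite le_max; apply/orP; right; apply: ereal_sup_ubound; exists x.
Qed.

Lemma semigroup_nat_mulSn T (k n : nat) x : semigroup T ->
  T (k.+1 * n)%:R x = T n%:R (T (k * n)%:R x).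
Proof. by move=> hT; rewrite mulSn natrD -(semigroupD hT) ?ler0n. Qed.

(** Inserting [T(n) Te(kn) x] gives the recursion [d_(k+1) <= lam * d_k + delta]. Invariance of [E]
    under [Te] keeps the perturbed orbit where the one-step error is known, and positive invariance
    of [U] keeps both orbits where [lam] applies. *)
Lemma orbit_deviation T Te U E (lam delta : R) (n : nat) :
  semigroup T -> semigroup Te -> positively_invariant T U -> E `<=` U ->
  (forall t : R, 0 <= t -> Te t @` E = E) ->
  lipschitz_with lam U (T n%:R) ->
  (forall x, E x -> mdist (T n%:R x) (Te n%:R x) <= delta) ->
  forall (k : nat) x, E x ->
    mdist (T (k * n)%:R x) (Te (k * n)%:R x) <=
      delta * (\sum_(j < k) lam ^+ j).
Proof.
move=> hT hTe TU EU TeE [lam0 lamT] deltaE k x Ex; elim: k => [|k ih].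
  by rewrite mul0n (semigroup0 hT) (semigroup0 hTe) mdistxx big_ord0 mulr0.
have ETe : E (Te (k * n)%:R x) by rewrite -(TeE (k * n)%:R)//; exists x.
have UT : U (T (k * n)%:R x).
  by apply: (TU (k * n)%:R); [exact: ler0n | exists x => //; exact: EU].
rewrite !semigroup_nat_mulSn//.
apply: (le_trans (metric_triangle _ (T n%:R (Te (k * n)%:R x)) _)).
rewrite big_ord_recl expr0 mulrDr mulr1 addrC lerD ?deltaE//.
apply: (le_trans (lamT _ _ UT (EU _ ETe))).
apply: (le_trans (ler_wpM2l lam0 ih)).
rewrite mulrCA mulr_sumr.
by under eq_bigr do rewrite -exprS.
Qed.

Lemma dist_H_attractor_le T Te A U Ae (C gamma alpha delta : R) (n : nat) :
  semigroup T -> positively_invariant T U ->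
  0 < C -> 0 < gamma ->
  (forall k : nat,
    (dist_H (T k%:R @` U) A <= (C * expR (- (gamma * k%:R)))%:E)%E) ->
  0 < alpha < 1 -> 1 <= gamma * (1 - alpha) / 2 * n%:R ->
  lipschitz_with (expR (gamma * (1 - alpha) / 2 * n%:R)) U (T n%:R) ->
  semigroup Te -> global_attractor Te Ae -> Ae `<=` U -> 0 <= delta ->
  (forall x, Ae x -> mdist (T n%:R x) (Te n%:R x) <= delta) ->
  (dist_H Ae A <= ((C + 1) * delta `^ alpha)%:E)%E.
Proof.
move=> hT TU C0 gamma0 Uexp alpha01 etan lipT hTe hAe AeU delta0 deltaAe.
(* The tradeoff takes a logarithm of [delta]. For [delta = 0] the bound follows by approximation:
   given [e > 0], the positive [d] with [(C + 1) * d^alpha = e] is also an admissible error. *)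
wlog {delta0} delta0 : delta deltaAe / 0 < delta.
  move=> wlg; have [/wlg|d0] := ltP 0 delta; first exact.
  have dE : delta = 0 by apply/eqP; rewrite eq_le d0.
  have a0 : alpha != 0 by case/andP: alpha01 => a0 _; rewrite gt_eqF.
  rewrite dE powR0// mulr0; apply/lee_addgt0Pr => e e0; rewrite add0e.
  have C10 : 0 < C + 1 by rewrite addr_gt0.
  pose d := (e / (C + 1)) `^ alpha^-1.
  have dgt0 : 0 < d by rewrite powR_gt0// divr_gt0.
  have -> : e = (C + 1) * d `^ alpha.
    rewrite /d -powRrM mulVf// powRr1 ?divr_ge0 ?(ltW e0) ?(ltW C10)//.
    by rewrite mulrCA divff ?mulr1// gt_eqF.
  apply: wlg => // x Ax; rewrite (le_trans (deltaAe x Ax))// dE; exact: ltW.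
have [k kle] := dist_error_tradeoff (ltW C0) gamma0 alpha01 delta0 etan.
rewrite ge_max lee_fin mulr_ge0 ?powR_ge0 ?addr_ge0 ?(ltW C0)//=.
apply: ge_ereal_sup => _ [a Aea <-].
have [b Aeb ba] : (Te (k * n)%:R @` Ae) a.
  by rewrite (attractor_inv hAe) ?ler0n.
have ab := orbit_deviation hT hTe TU AeU (attractor_inv hAe) lipT deltaAe
  k Aeb.
rewrite ba in ab.
have Tb : (ereal_inf [set (mdist (T (k * n)%:R b) c)%:E | c in A] <=
    (C * expR (- (gamma * (k * n)%:R)))%:E)%E.
  apply: le_trans (Uexp (k * n)%N); rewrite le_max; apply/orP; right.
  apply: ereal_sup_ubound; exists (T (k * n)%:R b) => //.
  by exists b => //; exact: AeU.
apply: (@le_trans _ _ ((delta * \sum_(j < k)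
    expR (gamma * (1 - alpha) / 2 * n%:R) ^+ j)%:E +
    (C * expR (- (gamma * (k * n)%:R)))%:E)%E); last first.
  by rewrite -EFinD lee_fin addrC.
(* Moving the deviation to the left leaves a lower bound for an infimum over [A], to be checked by
   the triangle inequality at each [c]. *)
rewrite -leeBlDl//; apply: le_trans Tb.
apply: le_ereal_inf_tmp => _ [c Ac <-]; rewrite leeBlDl//.
apply: (@le_trans _ _ (mdist a c)%:E).
  by apply: ereal_inf_lbound; exists c.
rewrite -EFinD lee_fin (le_trans (metric_triangle _ (T (k * n)%:R b) _))//.
by rewrite lerD2r metric_sym.
Qed.

(** The uniform distance may be [+oo], in which case the right-hand side is [+oo] too; otherwise it
    is itself a valid real [delta]. *)
Lemma dist_H_le_of_fin_Linfty_dist A U Ae F G (C alpha : R) :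
  0 < C -> 0 < alpha ->
  (forall delta : R, 0 <= delta ->
    (forall x, U x -> mdist (F x) (G x) <= delta) ->
    (dist_H Ae A <= (C * delta `^ alpha)%:E)%E) ->
  (dist_H Ae A <= C%:E * poweR (Linfty_dist U F G) alpha)%E.
Proof.
move=> C0 a0 H; have Linfty0 : (0 <= Linfty_dist U F G)%E.
  by rewrite le_max lexx.
have UFG := @mdist_le_Linfty_dist U F G.
case: (Linfty_dist U F G) Linfty0 UFG => [delta| |]//.
  by rewrite lee_fin poweR_EFin -EFinM => d0 UFG; apply: H.
by move=> _ _; rewrite poweRyr ?gt_eqF// gt0_muley ?lte_fin// leey.
Qed.

End Semigroups.

Unset Implicit Arguments.
Set Strict Implicit.

Theorem theorem5p3 (R : realType) (M : metricType R)
  (T : R -> M -> M) (A U : set M)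
  (hT : semigroup T) (hA : global_attractor T A)
  (hAU : A `<=` U) (hUbnd : mbounded U) (hUinv : positively_invariant T U)
  (hUexp : exp_attracted T A U)
  (hLip : exists k : R, lipschitz_with k U (T 1)) :
  [/\ (limn_esup (lip_ratio T U) = +oo%E ->
       exists C3 : R, 0 < C3 /\
       forall alpha : R, 0 < alpha < 1 ->
       exists N : nat,
       forall (Te : R -> M -> M) (Ae : set M),
         semigroup Te -> global_attractor Te Ae -> Ae `<=` U ->
         (dist_H Ae A <=
            C3%:E * poweR (Linfty_dist U (T N%:R) (Te N%:R)) alpha)%E),
      (lip_ratio T U n @[n --> \oo] --> +oo%E ->
       exists C3 : R, 0 < C3 /\
       forall alpha : R, 0 < alpha < 1 ->
       exists N : nat,
       forall (Te : R -> M -> M) (Ae : set M),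
         semigroup Te -> global_attractor Te Ae -> Ae `<=` U ->
         (dist_H Ae A <=
            C3%:E * ereal_inf [set poweR (Linfty_dist U (T n%:R) (Te n%:R)) alpha
                              | n in [set n : nat | (N <= n)%N]])%E) &
      (limn_esup (lip_ratio T U) = +oo%E ->
       lipschitz_shadowing A (T 1) ->
       forall alpha : R, 0 < alpha < 1 ->
       exists C3 : R, 0 < C3 /\
       forall (Te : R -> M -> M) (Ae : set M),
         semigroup Te -> global_attractor Te Ae -> Ae `<=` U ->
         (dist_H Ae A <=
            C3%:E * poweR (Linfty_dist U (T 1%R) (Te 1%R)) alpha)%E)].
Proof.
have [C [gamma [C0 gamma0 Uexp]]] := hUexp.
have C10 : 0 < C + 1 by rewrite addr_gt0.
pose eta (alpha : R) := gamma * (1 - alpha) / 2.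
have eta0 (alpha : R) : 0 < alpha < 1 -> 0 < eta alpha.
  by case/andP=> _ a1; rewrite divr_gt0// mulr_gt0// subr_gt0.
have eta_large (alpha : R) (n : nat) : 0 < alpha < 1 ->
    (Num.truncn (eta alpha)^-1 < n)%N -> 1 <= eta alpha * n%:R.
  move=> a01 nlarge; rewrite mulrC -ler_pdivrMr ?eta0// div1r.
  by rewrite (le_trans (ltW (truncnS_gt _)))// ler_nat.
(* The threshold [K = 1 / eta] turns the growth condition into the Lipschitz constant
   [exp(eta * n)]. *)
have lip_eta (alpha : R) (n : nat) : 0 < alpha < 1 ->
    ((eta alpha)^-1%:E < lip_ratio T U n)%E ->
    lipschitz_with (expR (eta alpha * n%:R)) U (T n%:R).
  move=> a01 /lip_ratio_lipschitz; rewrite invr_gt0 invrK mulrC.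
  by apply; exact: eta0.
have good_time (alpha : R) : limn_esup (lip_ratio T U) = +oo%E ->
    0 < alpha < 1 -> exists n : nat, 1 <= eta alpha * n%:R /\
      lipschitz_with (expR (eta alpha * n%:R)) U (T n%:R).
  move=> limsup a01.
  have [n nlarge ratio] := limn_esup_pinfty limsup (eta alpha)^-1
    (Num.truncn (eta alpha)^-1).+1.
  by exists n; split; [exact: eta_large | exact: lip_eta].
split.
- move=> limsup; exists (C + 1); split=> // alpha a01.
  have [N [etaN lipN]] := good_time alpha limsup a01.
  exists N => Te Ae hTe hAe AeU.
  apply: dist_H_le_of_fin_Linfty_dist => //; first by case/andP: a01.
  move=> delta delta0 Udelta.
  apply: (dist_H_attractor_le hT hUinv C0 gamma0 Uexp a01 etaN lipN hTe hAe AeU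
    delta0) => x /AeU; exact: Udelta.
- move=> /cvgeyPgt lim; exists (C + 1); split=> // alpha a01.
  have [N0 _ N0P] := lim (eta alpha)^-1.
  pose N := maxn N0 (Num.truncn (eta alpha)^-1).+1.
  exists N => Te Ae hTe hAe AeU.
  (* Dividing by [C + 1] reduces the bound by an infimum to one bound for each [n >= N]; a genuine
     limit makes every such [n] a good time. *)
  rewrite -lee_pdivrMl//; apply: le_ereal_inf_tmp => _ [n /= + <-].
  rewrite geq_max => /andP[N0n nlarge]; rewrite lee_pdivrMl//.
  apply: dist_H_le_of_fin_Linfty_dist => //; first by case/andP: a01.
  move=> delta delta0 Udelta.
  apply: (dist_H_attractor_le hT hUinv C0 gamma0 Uexp a01
    (eta_large _ _ a01 nlarge) (lip_eta _ _ a01 (N0P n N0n)) hTe hAe AeU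
    delta0) => x /AeU; exact: Udelta.
- move=> limsup _ alpha a01.
  have [N [etaN lipN]] := good_time alpha limsup a01.
  have [k lipk] := hLip.
  (* [N] unit steps turn an error [delta] at time 1 into at most [c * delta] at time [N]; the
     summand 1 makes [c > 0] immediate. Since [N] depends on [alpha], so does the resulting
     constant. *)
  pose c := 1 + \sum_(j < N) k ^+ j.
  have c0 : 0 < c.
    by rewrite ltr_pwDl// sumr_ge0// => j _; rewrite exprn_ge0//; case: lipk.
  exists ((C + 1) * c `^ alpha); split; first by rewrite mulr_gt0// powR_gt0.
  move=> Te Ae hTe hAe AeU.
  apply: dist_H_le_of_fin_Linfty_dist.
  + by rewrite mulr_gt0// powR_gt0.
  + by case/andP: a01.
  move=> delta delta0 Udelta; rewrite -mulrA -powRM ?(ltW c0)//.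
  apply: (dist_H_attractor_le hT hUinv C0 gamma0 Uexp a01 etaN lipN hTe hAe AeU).
    by rewrite mulr_ge0 ?(ltW c0).
  move=> x Aex.
  have := @orbit_deviation _ _ _ _ _ _ _ _ 1%N hT hTe hUinv AeU
    (attractor_inv hAe) lipk (fun y Ay => Udelta y (AeU y Ay)) N x Aex.
  rewrite muln1 => /le_trans; apply.
  by rewrite mulrC ler_wpM2r// lerDr.
Qed.
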